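(* For $n \geq 2$ let $CL_n$ be the graph of order $n$ obtained from the complete graph on $n-1$ vertices by attaching a leaf to one vertex, with degree polynomial $D(CL_n;x)$. The set of limits of zeros of the sequence of polynomials $D(CL_n;x)$, as $n\to\infty$, contains $0$ and the whole unit circle $\{z\in\mathbb{C} : |z|=1\}$.
   Context: The degree polynomial of a finite graph $G$ with vertex set $V$ is $D(G;x)=\sum_{v\in V} x^{\deg(v)}$. The graph $CL_n$ consists of a complete graph on $n-1$ vertices together with one additional vertex joined by a single edge to exactly one vertex of the complete graph; thus $D(CL_n;x)=x^{n-1}+(n-2)x^{n-2}+x$. A complex number $z$ is a limit of zeros of a sequence of polynomials $(P_n)$ if there is a sequence $(z_n)$ of complex numbers with $P_n(z_n)=0$ for all $n$ and $\lim_{n\to\infty} z_n=z$. *)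

(* Defs.v *)
From HB Require Import structures.
From mathcomp Require Import all_boot all_order all_algebra.
From mathcomp Require Import complex.
From mathcomp Require Import classical_sets reals topology normedtype sequences.

Set Implicit Arguments.
Unset Strict Implicit.
Unset Printing Implicit Defensive.

Import Order.TTheory GRing.Theory Num.Theory.
Import numFieldNormedType.Exports.

Local Open Scope classical_set_scope.
Local Open Scope complex_scope.
Local Open Scope ring_scope.

Record sgraph := SGraph {
  vertex :> finType;
  adj : rel vertex;
  adj_sym : symmetric adj;
  adj_irrefl : irreflexive adj
}.

Definition deg (G : sgraph) (v : G) : nat := #|[set u : G | adj v u]%SET|.

Definition degree_poly (A : nzRingType) (G : sgraph) : {poly A} :=
  \sum_(v : G) 'X^(deg v).

(* Vertices 0, ..., n-2 form the complete graph; the leaf n-1 is joined to the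
   vertex 0 only.  The graph is the intended one for n >= 2. *)
Definition CL_adj (n : nat) : rel 'I_n := fun i j =>
  (i != j) &&
  [|| (i < n.-1)%N && (j < n.-1)%N,
      (i == 0 :> nat) && (j == n.-1 :> nat)
    | (i == n.-1 :> nat) && (j == 0 :> nat)].

Lemma CL_adj_sym (n : nat) : symmetric (@CL_adj n).
Proof.
move=> i j; rewrite /CL_adj eq_sym [(i < _)%N && _]andbC; congr (_ && (_ || _)).
by rewrite orbC [X in X || _]andbC [X in _ || X]andbC.
Qed.

Lemma CL_adj_irrefl (n : nat) : irreflexive (@CL_adj n).
Proof. by move=> i; rewrite /CL_adj eqxx. Qed.

Definition CL (n : nat) : sgraph := SGraph (@CL_adj_sym n) (@CL_adj_irrefl n).

(* The sequence P is indexed by n >= n0; the values of z_ below n0 are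
   irrelevant. *)
Definition limits_of_zeros (C : numFieldType) (n0 : nat) (P : nat -> {poly C}) :
    set C :=
  [set z | exists z_ : nat -> C,
      (forall n, (n0 <= n)%N -> root (P n) (z_ n)) /\ z_ @ \oo --> z].

(* Main.v *)
Require Import Defs.
From HB Require Import structures.
From mathcomp Require Import all_boot all_order all_algebra.
From mathcomp Require Import complex.
From mathcomp Require Import classical_sets reals topology normedtype sequences.
From mathcomp Require Import boolp derive exp trigo ring lra.

Import Order.TTheory GRing.Theory Num.Theory.
Import numFieldNormedType.Exports.

Local Open Scope classical_set_scope.
Local Open Scope complex_scope.
Local Open Scope ring_scope.

(** Since the degree polynomial of [CL n] is divisible by [X], the constant
    sequence [0] shows that [0] is a limit of zeros.  For [n = m + 3] the
    remaining factor is the trinomial [p = X^m (X + m + 1) + 1], and every [w] on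
    the unit circle has to be approached by roots of [p].

    The roots of [p] satisfy [x ^ m = - 1 / (x + m + 1)].  Replacing [x] by [w] on
    the right gives an equation that can be solved explicitly: its solutions lie
    on a circle of radius [|w + m + 1| ^ (- 1 / m)], which tends to 1, and they are
    equally spaced there, so one of them is at distance [O(ln m / m)] from [w]
    ([nth_root_near]).  At such an [x] the value [p(x)] is tiny while the
    derivative [p'(x)] has order [m].

    To turn an approximate root into a root, one uses that a polynomial of degree
    [d] has a root within [d |p(x)| / |p'(x)|] of [x]
    ([root_within_newton_bound]), because [p'(x) / p(x)] is the sum of the [d]
    numbers [1 / (x - r)].  For the trinomial this distance is at most [|w - x|]
    ([trinomial_root_near]), so [p] has a root within [2 |w - x|] of [w], and
    [|w - x|] tends to 0. *)

(** * A root near a point where a polynomial is small *)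

(** This is the triangle inequality for the logarithmic derivative
    [p' / p = sum_r 1 / (x - r)], with denominators cleared: each of the terms
    has norm less than [1 / e]. *)
Lemma ltr_norm_deriv_roots (F : numFieldType) (rs : seq F) (x e : F) :
  rs != [::] -> 0 <= e -> (forall r, r \in rs -> e < `|x - r|) ->
  e * `|(\prod_(r <- rs) ('X - r%:P))^`().[x]|
    < (size rs)%:R * `|(\prod_(r <- rs) ('X - r%:P)).[x]|.
Proof.
move=> + e0; case: rs => // r rs _.
elim: rs r => [|s rs IHrs] r far.
  by rewrite big_seq1 derivXsubC !hornerE /= normr1 mulr1 far ?mem_head.
rewrite big_cons; set q := \prod_(j <- s :: rs) _.
have farr : e < `|x - r| by rewrite far ?mem_head.
have {}IHrs : e * `|q^`().[x]| < (size (s :: rs))%:R * `|q.[x]|.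
  by apply: IHrs => t trs; rewrite far// inE trs orbT.
have q0 : 0 < `|q.[x]|.
  rewrite normr_gt0 -/(root q x) root_prod_XsubC; apply/negP => xrs.
  by have := far x; rewrite inE xrs orbT subrr normr0 => /(_ isT);
    rewrite (le_gtF e0).
rewrite derivM derivXsubC mul1r hornerD !hornerM hornerXsubC normrM.
apply: (@le_lt_trans _ _ (e * `|q.[x]| + `|x - r| * (e * `|q^`().[x]|))).
  by rewrite [leRHS](_ : _ = e * (`|q.[x]| + `|(x - r) * q^`().[x]|))
     ?ler_wpM2l ?ler_normD// normrM; ring.
rewrite [ltRHS](_ : _ = `|x - r| * `|q.[x]|
    + `|x - r| * ((size (s :: rs))%:R * `|q.[x]|)); last first.
  by rewrite -[size [:: r, s & rs]]/(size (s :: rs)).+1 -natr1; ring.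
by rewrite ltrD// ?ltr_pM2r// ltr_pM2l// (le_lt_trans e0).
Qed.

(** If all roots were farther from [x] than [deg p * |p(x)| / |p'(x)|], the
    logarithmic derivative at [x] would be smaller than itself.  This is a
    substitute for Rouche's theorem that needs the polynomial at one point
    only. *)
Lemma root_within_newton_bound (F : numClosedFieldType) (p : {poly F}) (x : F) :
  p^`().[x] != 0 ->
  exists2 z, root p z &
    `|x - z| * `|p^`().[x]| <= (size p).-1%:R * `|p.[x]|.
Proof.
move=> dp0; have [rs pE] := closed_field_poly_normal p.
have a0 : lead_coef p != 0.
  by rewrite lead_coef_eq0; apply: contraNneq dp0 => ->; rewrite deriv0 horner0.
move: (lead_coef p) a0 pE dp0 => a a0 ->; set q := \prod_(r <- rs) _.
rewrite derivZ !hornerZ mulf_eq0 negb_or a0/= => dq0.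
rewrite size_scale// /q size_prod_XsubC/= -/q.
have rs0 : rs != [::].
  by apply: contraNneq dq0 => rs0; rewrite /q rs0 big_nil derivC horner0.
pose e := (size rs)%:R * `|q.[x]| / `|q^`().[x]|.
have dq_gt0 : 0 < `|q^`().[x]| by rewrite normr_gt0.
have e0 : 0 <= e by rewrite divr_ge0// mulr_ge0.
have [/hasP[z zrs ze]|/hasPn far] := boolP (has (fun r => `|x - r| <= e) rs).
  exists z; first by rewrite rootZ// root_prod_XsubC.
  rewrite !normrM mulrCA [leRHS]mulrCA ler_wpM2l//.
  by rewrite -ler_pdivlMr.
have /(@ltr_norm_deriv_roots _ _ x _ rs0 e0) : forall r, r \in rs -> e < `|x - r|.
  by move=> r /far; rewrite real_leNgt ?negbK// ger0_real.
by rewrite -/q /e divfK ?ltxx// gt_eqF.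
Qed.

(** * Points of the unit circle and their angles *)

Definition cis {R : realType} (t : R) : R[i] := cos t +i* sin t.

Lemma norm_cis (R : realType) (t : R) : `|cis t| = 1.
Proof. by rewrite normc_def/= cos2Dsin2 sqrtr1. Qed.

Lemma cisD (R : realType) (t u : R) : cis (t + u) = cis t * cis u.
Proof.
by apply/eqP; rewrite eq_complex/= cosD sinD; apply/andP; split; apply/eqP; ring.
Qed.

Lemma cis0 (R : realType) : cis 0 = 1 :> R[i].
Proof. by rewrite /cis cos0 sin0. Qed.

Lemma cisMn (R : realType) (t : R) (n : nat) : cis (t *+ n) = cis t ^+ n.
Proof. by elim: n => [|n IH]; rewrite ?cis0// mulrS cisD IH exprS. Qed.

Lemma cis2pi (R : realType) (k : int) : cis ((pi *+ 2) *~ k) = 1 :> R[i].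
Proof.
have c1 : cis (pi *+ 2) = 1 :> R[i] by rewrite /cis cos2pi sin2pi.
case: k => n; first by rewrite -pmulrn cisMn c1 expr1n.
have : cis ((pi *+ 2) *~ Negz n + (pi *+ 2) *~ n.+1) = 1 :> R[i].
  by rewrite -mulrzDr NegzE addNr mulr0z cis0.
by rewrite cisD -pmulrn cisMn c1 expr1n mulr1.
Qed.

(** The arccosine of the real part is the angle, up to a sign that the
    imaginary part decides. *)
Lemma cis_surj (R : realType) (w : R[i]) : `|w| = 1 -> exists t, w = cis t.
Proof.
case: w => a b; rewrite normc_def/= => -[/eqP].
rewrite -[X in _ == X]sqrtr1 eqr_sqrt ?addr_ge0 ?sqr_ge0// => /eqP ab.
have a1 : -1 <= a <= 1.
  by rewrite -ler_norml -(ler_pXn2r (n:=2))// ?nnegrE// real_normK ?num_real//; nra.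
have sE : Num.sqrt (1 - a ^+ 2) = `|b| by rewrite -sqrtr_sqr; congr Num.sqrt; lra.
have [b0|b0] := leP 0 b.
  by exists (acos a); rewrite /cis acosK ?in_itv//= sin_acos// sE ger0_norm.
exists (- acos a).
by rewrite /cis cosN sinN acosK ?in_itv//= sin_acos// sE ltr0_norm// opprK.
Qed.

Lemma normc_le_sum (R : realType) (a b : R) : `|a +i* b| <= (`|a| + `|b|)%:C.
Proof.
rewrite normc_def/= lecR -[leRHS]ger0_norm ?addr_ge0//.
rewrite -[leRHS]sqrtr_sqr ler_wsqrtr//.
rewrite sqrrD !real_normK ?num_real//.
have : 0 <= `|a| * `|b| by exact: mulr_ge0.
lra.
Qed.

Lemma lip1_of_derive (R : realType) (f df : R -> R) :
  (forall x : R, is_derive x (1 : R) f (df x)) -> (forall x, `|df x| <= 1) ->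
  forall t u : R, `|f t - f u| <= `|t - u|.
Proof.
move=> fdf df1.
suff le_case (t u : R) : t <= u -> `|f t - f u| <= `|t - u|.
  move=> t u; have [/le_case//|/ltW/le_case] := leP t u.
  by rewrite distrC [leRHS]distrC.
move=> tu.
have cf : {within `[t, u], continuous f}.
  by apply: derivable_within_continuous => x _; exact: ex_derive.
have [c _ fE] := MVT_segment tu (fun x _ => fdf x) cf.
by rewrite distrC fE normrM [leRHS]distrC ler_piMl.
Qed.

Lemma cis_lip (R : realType) (t u : R) : `|cis t - cis u| <= (2 * `|t - u|)%:C.
Proof.
apply: (le_trans (normc_le_sum _ _ _)); rewrite lecR mulr_natl mulr2n lerD//=.
- apply: (@lip1_of_derive R cos (fun x => - sin x)) => x.
  by rewrite normrN ler_norml sin_geN1 sin_le1.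
- by apply: (@lip1_of_derive R sin cos) => x; rewrite ler_norml cos_geN1 cos_le1.
Qed.

(** The number [c] has [m] roots of order [m]: they are equally spaced on the
    circle of radius [|c| ^ (1/m) = exp (- l / m)], which is within [l / m] of
    the unit circle, and so one of them has an angle within [2 pi / m] of the
    angle of [w].  The constant [4 pi] is twice this, because the chord between
    two points is estimated through their two coordinates separately. *)
Lemma nth_root_near (R : realType) (w c : R[i]) (l : R) (m : nat) :
  (0 < m)%N -> 0 <= l -> `|w| = 1 -> `|c| = (expR (- l))%:C ->
  exists x, [/\ x ^+ m = c, `|x| <= 1 & `|w - x| <= ((l + pi *+ 4) / m%:R)%:C].
Proof.
move=> m0 l0 /cis_surj[t ->{w}] cl.
have m0R : 0 < m%:R :> R by rewrite ltr0n.
have /cis_surj[u cE] : `|c / (expR (- l))%:C| = 1.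
  rewrite normf_div cl ger0_norm ?divff//.
    by rewrite -(rmorph0 (real_complex R)) (inj_eq (@complexI _)) gt_eqF ?expR_gt0.
  by rewrite ler0c expR_ge0.
have {}cE : c = (expR (- l))%:C * cis u.
  rewrite -cE mulrC divfK//.
  by rewrite -(rmorph0 (real_complex R)) (inj_eq (@complexI _)) gt_eqF ?expR_gt0.
(* The angles [(u + 2 pi k) / m] are those of the roots of [c]; this [k] gives
   the last one that does not exceed [t]. *)
pose k := Num.floor ((t *+ m - u) / (pi *+ 2)).
pose v := (u + (pi *+ 2) *~ k) / m%:R.
have vm : v *+ m = u + (pi *+ 2) *~ k by rewrite -mulr_natr divfK// gt_eqF.
have pi2 : 0 < pi *+ 2 :> R by rewrite mulrn_wgt0 ?pi_gt0.
have tv : `|t - v| <= pi *+ 2 / m%:R.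
  have -> : t - v = (t *+ m - v *+ m) / m%:R.
    by rewrite -mulrnBl -[(t - v) *+ m]mulr_natr mulfK// gt_eqF.
  rewrite normrM [`|m%:R^-1|]ger0_norm ?invr_ge0 ?ler0n//.
  rewrite ler_pM2r ?invr_gt0// vm.
  have : (k%:~R <= (t *+ m - u) / (pi *+ 2) < (k + 1)%:~R).
    exact: Num.Theory.floor_itv.
  rewrite ler_pdivlMr// ltr_pdivrMr// => /andP[].
  rewrite intrD rmorph1 mulrDl mul1r mulrzl => lo hi.
  by rewrite ger0_norm; lra.
pose rho := expR (- l / m%:R).
have rho_m : rho ^+ m = expR (- l).
  by rewrite -expRM_natl mulrC divfK// gt_eqF.
have rho_le1 : rho <= 1.
  by rewrite -expR0 ler_expR mulNr oppr_le0 divr_ge0// ler0n.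
have rho_ge : 1 - l / m%:R <= rho by rewrite -mulNr expR_ge1Dx.
have norm_rho (r : R) : 0 <= r -> `|r%:C| = r%:C.
  by move=> r0; rewrite ger0_norm// ler0c.
exists (rho%:C * cis v); split.
- by rewrite exprMn -rmorphXn rho_m -cisMn vm cisD cis2pi mulr1.
- rewrite normrM norm_cis mulr1 norm_rho ?expR_ge0//.
  by rewrite -(rmorph1 (real_complex R)) lecR.
- have -> : cis t - rho%:C * cis v = cis t - cis v + (1 - rho)%:C * cis v.
    by rewrite rmorphB rmorph1 mulrBl mul1r addrA subrK.
  apply: (le_trans (ler_normD _ _)).
  rewrite normrM norm_cis mulr1 norm_rho ?subr_ge0//.
  apply: le_trans (lerD (cis_lip _ _ _) (lexx _)) _.
  have -> : (l + pi *+ 4) / m%:R = l / m%:R + 2 * (pi *+ 2 / m%:R).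
    by rewrite mulrDl mulrA mulr_natl -(mulrnA pi 2 2).
  rewrite -rmorphD lecR addrC lerD//; first by rewrite lerBlDr -lerBlDl.
  by rewrite ler_pM2l// ltr0n.
Qed.

(** * Roots of X^m (X + m + 1) + 1 near the unit circle *)

(** Freezing the slowly varying factor [X + m + 1] at [w] turns the equation
    into [x ^ m = - 1 / (w + m + 1)], which has a solution [x] near [w].  Writing
    [p] for the trinomial, one finds
      [p(x) = (w - x) / (w + m + 1)] and
      [x p'(x) = - (m + 1) (x + m) / (w + m + 1)],
    so that the bound [deg p * |p(x)| / |p'(x)|] on the distance from [x] to a
    root is [|x| |w - x| / |x + m|], at most [|w - x|]. *)
Lemma trinomial_root_near (R : realType) (w : R[i]) (m : nat) :
  (1 < m)%N -> `|w| = 1 ->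
  exists2 z, root ('X^m * ('X + m.+1%:R%:P) + 1) z &
    `|w - z| <= ((ln (m.+2%:R) + pi *+ 4) / m%:R *+ 2)%:C.
Proof.
move=> m1 w1; have m0 : (0 < m)%N by exact: ltnW.
set p : {poly R[i]} := _ + 1.
have w_ge : m%:R <= `|w + m.+1%:R|.
  rewrite addrC; have := lerB_normD (m.+1%:R) w.
  by rewrite normr_nat w1 -{1}natr1 addrK.
have w_le : `|w + m.+1%:R| <= m.+2%:R.
  by rewrite (le_trans (ler_normD _ _))// normr_nat w1 nat1r.
have wm0 : w + m.+1%:R != 0.
  by rewrite -normr_gt0 (lt_le_trans _ w_ge)// ltr0n.
pose a := complex.Re `|w + m.+1%:R|.
have aE : `|w + m.+1%:R| = a%:C by rewrite RRe_real// normr_real.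
have mC (k : nat) : k%:R = (k%:R : R)%:C by rewrite rmorph_nat.
have a_ge : m%:R <= a by rewrite -lecR -aE -mC.
have a_le : a <= m.+2%:R by rewrite -lecR -aE -mC.
have a_ge1 : 1 <= a by rewrite (le_trans _ a_ge)// ler1n.
have a_gt0 : 0 < a by rewrite (lt_le_trans _ a_ge1).
have [||x [xm x1 xw]] := @nth_root_near R w (- (w + m.+1%:R)^-1) (ln a) m m0 _ w1.
- exact: ln_ge0.
- by rewrite normrN normfV aE expRN lnK// fmorphV.
have W1 : (w + m.+1%:R)^-1 * (w + m.+1%:R) = 1 by rewrite mulVf.
have px : p.[x] * (w + m.+1%:R) = w - x.
  rewrite !hornerE xm mulrDl mulNr mulNr mulrAC W1 mul1r mul1r.
  by move: (m.+1%:R) => d; ring.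
have dpx : p^`().[x] * x * (w + m.+1%:R) = - (m.+1%:R * (x + m%:R)).
  rewrite derivD derivM derivXn derivD derivX !derivC addr0 addr0 mulr1 !hornerE.
  have -> : (('X^(m.-1) *+ m).[x] * (x + m.+1%:R) + x ^+ m) * x
            = x ^+ m * (m%:R * (x + m.+1%:R) + x).
    rewrite hornerMn hornerXn -(mulr_natr _ m).
    rewrite -[in x ^+ m](prednK m0) exprSr.
    by move: (x ^+ m.-1) (m%:R) (m.+1%:R) => y b d; ring.
  rewrite xm 2!mulNr mulrAC W1 mul1r -natr1.
  by move: (m%:R) => b; ring.
have x0 : x != 0.
  apply: contraTneq wm0 => x0; rewrite negbK -invr_eq0 -oppr_eq0 -xm x0.
  by rewrite expr0n gtn_eqF.
have xm_ge1 : 1 <= `|x + m%:R|.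
  rewrite addrC (le_trans _ (lerB_normD _ _))// normr_nat lerBrDr.
  by rewrite (@le_trans _ _ 2%:R) ?ler_nat// -nat1r lerD2l.
have xm0 : x + m%:R != 0 by rewrite -normr_gt0 (lt_le_trans _ xm_ge1).
have dp0 : p^`().[x] != 0.
  apply: contraTneq isT => dp0; move/eqP: dpx.
  by rewrite dp0 !mul0r eq_sym oppr_eq0 mulf_eq0 pnatr_eq0 (negPf xm0).
have [z pz hz] := @root_within_newton_bound _ p x dp0; exists z => //.
have size_p : ((size p).-1 <= m.+1)%N.
  rewrite -subn1 leq_subLR add1n /p (leq_trans (size_polyD _ _))//.
  rewrite geq_max size_poly1 andbT (leq_trans (size_polyMleq _ _))//.
  by rewrite size_polyXn size_XaddC addnC.
have W0 : 0 < `|w + m.+1%:R| by rewrite normr_gt0.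
have xz : `|x - z| <= `|w - x|.
  rewrite -(@ler_pM2r _ (m.+1%:R * `|x + m%:R|)); last first.
    by rewrite mulr_gt0 ?ltr0n// normr_gt0.
  rewrite [in leLHS](_ : m.+1%:R * `|x + m%:R|
    = `|p^`().[x]| * `|x| * `|w + m.+1%:R|); last first.
    by rewrite -!normrM dpx normrN normrM normr_nat.
  rewrite mulrA mulrA.
  apply: le_trans (_ : _ <= (size p).-1%:R * `|p.[x]| * `|x| * `|w + m.+1%:R|) _.
    by rewrite !ler_pM2r ?normr_gt0.
  rewrite mulrAC -[_ * `|p.[x]| * _]mulrA -normrM px.
  rewrite [leRHS](_ : _ = m.+1%:R * `|w - x| * `|x + m%:R|); last first.
    by rewrite mulrCA mulrA.
  rewrite ler_pM// ?mulr_ge0//.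
    by rewrite ler_wpM2r// ler_nat.
  exact: le_trans x1 xm_ge1.
have {}xw : `|w - x| <= ((ln m.+2%:R + pi *+ 4) / m%:R)%:C.
  rewrite (le_trans xw)// lecR ler_pM2r ?invr_gt0 ?ltr0n// lerD2r ler_ln//.
  by rewrite posrE ltr0n.
rewrite (le_trans (ler_distD x _ _))// mulr2n rmorphD lerD//.
by rewrite (le_trans xz).
Qed.

(** The logarithm is absorbed by half a power of [m]: [ln (m + 2)] is at most
    [2 ln (2 sqrt m)], hence at most [4 sqrt m]. *)
Lemma ln_rate (R : realType) (m : nat) : (0 < m)%N ->
  (ln m.+2%:R + pi *+ 4) / m%:R *+ 2 <= (8 + pi *+ 8) / Num.sqrt m%:R :> R.
Proof.
move=> m0; set s := Num.sqrt m%:R.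
have ss : m%:R = s * s :> R by rewrite -expr2 sqr_sqrtr.
have s1 : 1 <= s by rewrite -sqrtr1 ler_wsqrtr// ler1n.
have s0 : 0 < s by rewrite (lt_le_trans _ s1).
have lnm : ln (m.+2%:R : R) <= 4 * s.
  have m2 : m.+2%:R <= (2 * s) ^+ 2 :> R.
    rewrite exprMn sqr_sqrtr// -natrX -natrM ler_nat.
    rewrite -addn2 (leq_trans (leq_add (leqnn m) (leq_pmulr 2 m0)))//.
    by rewrite -mulSn leq_mul2r orbT.
  apply: (@le_trans _ _ (ln ((2 * s) ^+ 2))).
    by rewrite ler_ln ?posrE ?exprn_gt0 ?mulr_gt0 ?ltr0n.
  rewrite lnXn ?mulr_gt0// mulr2n.
  have : ln (2 * s) < 2 * s by rewrite ln_sublinear// mulr_gt0.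
  lra.
have pi0 : 0 <= pi *+ 4 :> R by rewrite mulrn_wge0 ?pi_ge0.
rewrite ss invfM mulrA -mulrnAl ler_pM2r ?invr_gt0//.
rewrite -mulrnAl ler_pdivrMr// (_ : 8 + pi *+ 8 = (4 + pi *+ 4) *+ 2); last first.
  by move: (pi : R) => p; ring.
rewrite mulrnAl lerMn2r/= mulrDl lerD//.
by rewrite ler_peMr.
Qed.

(** * The degree polynomial of CL n *)

(** The middle term collects the vertices of the clique other than the one that
    carries the leaf. *)
Lemma degree_poly_CL (A : nzRingType) (k : nat) :
  degree_poly A (CL k.+2) = 'X^(k.+1) + 'X^k *+ k + 'X.
Proof.
have deg_hub : deg (ord0 : CL k.+2) = k.+1.
  rewrite /deg (_ : [set u | _] = [set~ ord0])%SET ?cardsC1 ?card_ord//.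
  apply/setP => j; rewrite !inE /= /CL_adj /= eq_sym.
  by rewrite orbF orbC -leq_eqVlt -ltnS ltn_ord andbT.
have deg_leaf : deg (ord_max : CL k.+2) = 1%N.
  rewrite /deg -(cards1 (ord0 : 'I_k.+2)); apply: eq_card => j.
  rewrite !inE /= /CL_adj /= ltnn eqxx /=.
  rewrite -val_eqE /=.
  by case: j => -[|j] /= jk; rewrite ?andbF.
have deg_clique (i : 'I_k) : deg (lift ord0 (widen_ord (leqnSn k) i) : CL k.+2) = k.
  set v := lift _ _.
  have vE : v = i.+1 :> nat by [].
  clearbody v.
  have vm : v != ord_max by rewrite -(inj_eq val_inj) /= vE eqSS ltn_eqF.
  rewrite /deg (_ : [set u | _] = ~: [set v; ord_max])%SET.
    by rewrite cardsCs finset.setCK cards2 vm card_ord subn2.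
  apply/setP => j; rewrite !inE /= /CL_adj vE /= ltnS ltn_ord /= eqSS.
  rewrite [(i == k :> nat)]ltn_eqF// orbF.
  rewrite -[v == j]val_eqE -[j == v]val_eqE negb_or eq_sym.
  congr andb; rewrite -val_eqE /=.
  by rewrite ltn_neqAle -ltnS ltn_ord andbT.
rewrite /degree_poly big_ord_recl big_ord_recr /= deg_hub.
rewrite (_ : lift ord0 ord_max = ord_max); last exact: val_inj.
rewrite deg_leaf expr1 addrA; congr (_ + _ + _).
under eq_bigr => i _ do rewrite deg_clique.
by rewrite sumr_const card_ord.
Qed.

Lemma degree_poly_CL_trinomial (A : comNzRingType) (m : nat) :
  degree_poly A (CL m.+3) = 'X * ('X^m * ('X + m.+1%:R%:P) + 1).
Proof.
rewrite degree_poly_CL mulrDr mulr1; congr (_ + _).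
by rewrite mulrA -exprS mulrDr -exprSr polyC_natr mulr_natr.
Qed.

(** * Limits of zeros *)

Lemma CL_root_near (R : realType) (w : R[i]) (n : nat) : `|w| = 1 ->
  (5 <= n)%N ->
  exists2 z, root (degree_poly R[i] (CL n)) z &
    `|w - z| <= ((8 + pi *+ 8) / Num.sqrt (n - 3)%:R)%:C.
Proof.
move=> w1; case: n => [|[|[|m]]]// m1; rewrite -[(m.+3 - 3)%N]/(m - 0)%N subn0.
have [z pz wz] := @trinomial_root_near R w m m1 w1; exists z.
  by rewrite degree_poly_CL_trinomial rootM pz orbT.
by rewrite (le_trans wz)// lecR ln_rate// ltnW.
Qed.

Theorem proposition2p4 (R : realType) :
  [set 0] `|` [set z : R[i] | `|z| = 1] `<=`
  limits_of_zeros 2 (fun n : nat => degree_poly R[i] (CL n)).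
Proof.
have root0 n : (2 <= n)%N -> root (degree_poly R[i] (CL n)) 0.
  case: n => [|[|[|m]]]// _; last first.
    by rewrite degree_poly_CL_trinomial rootM rootX eqxx.
  by rewrite degree_poly_CL mulr0n addr0 rootE !hornerE ?addr0.
move=> w /= [->|w1].
  by exists (fun=> 0); split=> //; exact: cvg_cst.
have /choice[z_ hz] n : exists z, ((2 <= n)%N -> root (degree_poly R[i] (CL n)) z)
    /\ ((5 <= n)%N -> `|w - z| <= ((8 + pi *+ 8) / Num.sqrt (n - 3)%:R)%:C).
  have [n5|n5] := leqP 5 n; last by exists 0; split => //; exact: root0.
  by have [z rz wz] := CL_root_near _ _ _ w1 n5; exists z.
exists z_; split=> [n n2|]; first exact: (hz n).1.
apply/cvgrPdist_le => e e0.
pose K : R := 8 + pi *+ 8.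
have K0 : 0 <= K by rewrite addr_ge0// mulrn_wge0// pi_ge0.
pose r := complex.Re e.
have eE : e = r%:C by rewrite RRe_real// gtr0_real.
have r0 : 0 < r by rewrite -ltcR -eE.
near=> n.
have n5 : (5 <= n)%N by near: n; exact: nbhs_infty_ge.
rewrite (le_trans ((hz n).2 n5))// eE lecR -/K.
have s0 : 0 < Num.sqrt (n - 3)%:R :> R.
  by rewrite sqrtr_gt0 ltr0n subn_gt0 (leq_trans _ n5).
rewrite ler_pdivrMr// mulrC -ler_pdivrMr//.
rewrite -(ler_pXn2r (n:=2)) ?nnegrE ?divr_ge0 ?(ltW s0) ?(ltW r0)// sqr_sqrtr//.
rewrite natrB ?(leq_trans _ n5)// lerBrDr.
by near: n; exact: nbhs_infty_ger.
Unshelve. all: by end_near.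
Qed.
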